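(* Let $Z,\varepsilon_1,\varepsilon_2,\ldots$ be independent centred normally distributed random variables with $\operatorname{Var}(Z)=\sigma_1^2>0$ and $\operatorname{Var}(\varepsilon_n)=\sigma_2^2>0$ for all $n\ge1$, and let $(\beta_n)_{n\ge1}$ be a nondecreasing sequence of nonnegative numbers. Define $$S_n=\beta_nZ+\varepsilon_n,\quad n\ge1.$$ If $(\beta_{j+1}-\beta_j)\beta_j\sigma_1^2\ge\sigma_2^2$ for all $j\ge1$, then $\{S_n,\,n\ge1\}$ is a demimartingale.
   Context: Functions are understood to be Borel measurable. A sequence of $L^1$ random variables $(S_n)_{n\ge1}$ is a demimartingale if for all $j\ge1$, $E[(S_{j+1}-S_j)f(S_1,\ldots,S_j)]\ge 0$ for all componentwise nondecreasing functions $f:\mathbb{R}^j\to\mathbb{R}$ for which the expectation is defined. *)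

(* Defs.v *)
From HB Require Import structures.
From mathcomp Require Import all_boot all_order all_algebra.
From mathcomp Require Import all_classical all_reals all_analysis.

Set Implicit Arguments.
Unset Strict Implicit.
Unset Printing Implicit Defensive.

Import Order.TTheory GRing.Theory Num.Theory.
Import numFieldNormedType.Exports.

Local Open Scope classical_set_scope.
Local Open Scope ring_scope.

(* The two set functions are compared on Borel sets only: their values on
   other sets are meaningless. The condition s != 0 is needed because
   normal_prob m 0 is, by convention, a uniform law. *)
Definition normally_distributed (d : measure_display) (T : measurableType d)
    (R : realType) (P : probability T R) (X : {RV P >-> R}) : Prop :=
  exists m s : R, s != 0 /\
    forall A : set R, measurable A -> distribution P X A = normal_prob m s A.

(* Product rule over every finite subfamily, enumerated without repetition. *)
Definition mutually_independent (d : measure_display) (T : measurableType d)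
    (R : realType) (P : probability T R) (I : eqType)
    (X : I -> {RV P >-> R}) : Prop :=
  forall (s : seq I) (A : I -> set R),
    uniq s -> (forall i, measurable (A i)) ->
    P (\bigcap_(i in [set` s]) (X i @^-1` A i)) =
    (\prod_(i <- s) P (X i @^-1` A i))%E.

(* The expectation exists in [-oo, +oo]. *)
Definition expectation_defined (d : measure_display) (T : measurableType d)
    (R : realType) (P : probability T R) (Y : T -> R) : Prop :=
  ('E_P[Y^\+] < +oo)%E \/ ('E_P[Y^\-] < +oo)%E.

Definition componentwise_nondecreasing (R : realType) (n : nat)
    (f : n.-tuple R -> R) : Prop :=
  forall x y : n.-tuple R, (forall i, tnth x i <= tnth y i) -> f x <= f y.

(* Sequences are indexed from 0, so f takes the j.+1 variables X_0, ..., X_j.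
   The sigma-algebra on tuples is the product of the Borel ones. *)
Definition demimartingale (d : measure_display) (T : measurableType d)
    (R : realType) (P : probability T R) (X : nat -> T -> R) : Prop :=
  (forall n, X n \in Lfun P 1) /\
  forall (j : nat) (f : j.+1.-tuple R -> R),
    measurable_fun setT f ->
    componentwise_nondecreasing f ->
    let Y := fun w => (X j.+1 w - X j w) * f [tuple X i w | i < j.+1] in
    expectation_defined P Y -> (0 <= 'E_P[Y])%E.

(* Main.v *)
Require Import Defs.
From HB Require Import structures.
From mathcomp Require Import all_boot all_order all_algebra.
From mathcomp Require Import ring lra.
From mathcomp Require Import all_classical all_reals all_analysis.
From mathcomp Require Import measurable_realfun.

(** Fix [j] and write [Y = (S_(j+1) - S_j) f(S_0, ..., S_j)], [beta = beta_j],
    [g = beta_(j+1) - beta_j].  Let [s], [t] be the scale parameters of the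
    normal laws of [Z] and [eps_j], that is, their standard deviations, and let
    [k = beta s ^ 2 / (beta ^ 2 s ^ 2 + t ^ 2)] be the regression coefficient
    of [Z] on [S_j].  Then

      [S_(j+1) - S_j =
         eps_(j+1) + ((g + beta) k - 1) S_j + (g + beta) (Z - k S_j)],

    and the growth condition says exactly that the coefficient of [S_j] is
    nonnegative, while it forces [beta > 0], hence [k > 0].  So it suffices to show that [E[L f(S_0, ..., S_j)] >= 0] for
    [L] each of [eps_(j+1)], [S_j] and the residual [Z - k S_j].

    Each [L] is treated by a reflection.  The joint law of [Z] and the one
    [eps_i] occurring in [L] is invariant under the linear reflection that
    changes the sign of [L] and fixes the linear combinations uncorrelated with
    [L]; call [S'_i] the reflected [S_i].  As the other [eps_i] are independent
    of this pair, reflecting it preserves the law of the whole family, hence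
    [2 E[L f(S)] = E[L (f(S) - f(S'))]].  For the three [L] above,
    [S_i - S'_i] is a nonnegative multiple of [L] for every [i <= j]; since [f]
    is nondecreasing, the last integrand is pointwise nonnegative
    ([reflection_expectation_ge0], [linear_model_bounded]).  The invariance
    itself ([normal_prob2_refl]) only uses that Lebesgue measure is invariant
    under translations and sign changes, because the reflection is a
    composition of shears and a sign change and preserves the quadratic form in
    the exponent.

    Reflections also identify the parameters of the normal laws: the symmetry
    of a normal law about its location parameter gives the location [0]
    ([normal_centred_mean0]), and a reflection that exchanges two independent
    normal variables up to scaling shows that their variances are proportional
    to the squares of their scale parameters ([variance_ratio]), so the growth
    condition may be read with the scale parameters, without computing a
    Gaussian second moment.

    The above requires [L f] to be integrable, which holds for bounded [f].  A
    general [f] is replaced by its truncations [clip N \o f], and monotone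
    convergence gives [E[Y^-] <= E[Y^+]] ([expectation_ge0_clip]), whence
    [E[Y] >= 0] when one of the two is finite. *)

Set Implicit Arguments.
Unset Strict Implicit.
Unset Printing Implicit Defensive.

Import Order.TTheory GRing.Theory Num.Theory.
Import numFieldNormedType.Exports.
Local Open Scope classical_set_scope.
Local Open Scope ring_scope.

(** * Finite measures determined by rectangles *)

Lemma prod_measure_rect_unique d1 d2 (T1 : measurableType d1)
    (T2 : measurableType d2) (R : realType)
    (m1 m2 : {measure set (T1 * T2) -> \bar R}) :
  (m1 setT < +oo)%E ->
  (forall A B, measurable A -> measurable B -> m1 (A `*` B) = m2 (A `*` B)) ->
  forall C, measurable C -> m1 C = m2 C.
Proof.
move=> m1oo m12 C mC.
pose G := [set A `*` B | A in @measurable _ T1 & B in @measurable _ T2].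
apply: (measure_unique G (fun=> setT)) => //.
- by rewrite measurable_prod_measurableType.
- move=> _ _ [A mA [B mB <-]] [A' mA' [B' mB' <-]]; rewrite -setXI.
  exists (A `&` A'); first exact: measurableI.
  by exists (B `&` B') => //; exact: measurableI.
- by move=> _; exists setT => //; exists setT => //; rewrite setXTT.
- by rewrite bigcup_const //; exists 0%N.
- by move=> _ [A mA [B mB <-]]; exact: m12.
Qed.

Lemma tuple_measure_rect_unique d (T : measurableType d) (R : realType)
    (n : nat) (m1 m2 : {measure set (n.-tuple T) -> \bar R}) :
  (m1 setT < +oo)%E ->
  (forall A : 'I_n -> set T, (forall i, measurable (A i)) ->
     m1 [set x | forall i, A i (tnth x i)] =
     m2 [set x | forall i, A i (tnth x i)]) ->
  forall C, measurable C -> m1 C = m2 C.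
Proof.
move=> m1oo m12 C mC.
pose G := [set C : set (n.-tuple T) | exists2 A : 'I_n -> set T,
  (forall i, measurable (A i)) & C = [set x | forall i, A i (tnth x i)]].
have mG : G `<=` measurable.
  move=> _ [A mA ->].
  rewrite (_ : [set x | _] =
      \big[setI/setT]_(i < n) ((@tnth n T)^~ i @^-1` A i)); last first.
    rewrite -bigcap_seq; apply/seteqP; split => x /= h i; last first.
      by apply: h; exact: mem_index_enum.
    by move=> _; exact: h.
  apply: bigsetI_measurable => i _; rewrite -[X in measurable X]setTI.
  exact: measurable_tnth.
have GT : G setT.
  by exists (fun=> setT) => //; apply/seteqP; split.
apply: (g_sigma_algebra_measure_unique G mG (fun=> setT)) => //.
- by rewrite bigcup_const //; exists 0%N.
- move=> _ _ [A mA ->] [B mB ->]; exists (fun i => A i `&` B i).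
    by move=> i; exact: measurableI.
  apply/seteqP; split => x /=; first by move=> [a b] i; split.
  by move=> h; split => i; have [] := h i.
- by move=> _ [A mA ->]; exact: m12.
move: mC; apply: sub_sigma_algebra2; rewrite -bigcup_seq => B [i _] [A mA <-].
exists (fun j => if j == i then A else setT); first by move=> j; case: ifP.
rewrite setTI; apply/seteqP; split => x /=.
  by move=> ? j; case: eqP => // ->.
by move=> /(_ i); rewrite eqxx.
Qed.

(** * Translations and sign changes of the Lebesgue measure *)

Section lebesgue.
Context {R : realType}.
Local Notation mu := (@lebesgue_measure R).

Lemma lebesgue_measure_addr (c : R) (A : set R) : measurable A ->
  pushforward mu ((fun x => c + x) : _ -> measurableTypeR R) A = mu A.
Proof.
move=> mA; apply/esym/lebesgue_measure_unique => //=.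
  exact: measurable_funD.
move=> ? _ [[a b]] _ <-.
rewrite /pushforward (_ : _ @^-1` _ = `]a - c, b - c]%classic); last first.
  apply/seteqP; split => x /=; rewrite !in_itv/= ltrBlDl lerBrDl //.
rewrite !lebesgue_measure_itv/= !lte_fin ltrD2r -!EFinB.
by case: ifP => // _; congr EFin; ring.
Qed.

Lemma ge0_integral_addr (c : R) (f : R -> \bar R) :
  measurable_fun setT f -> (forall x, 0 <= f x)%E ->
  (\int[mu]_x f (c + x)%R = \int[mu]_x f x)%E.
Proof.
move=> mf f0.
have mc : measurable_fun setT
    ((fun x => c + x) : measurableTypeR R -> measurableTypeR R).
  exact: measurable_funD.
rewrite -(@ge0_integral_pushforward _ _ _ _ _ _ mc mu setT f) //.
apply: eq_measure_integral => A mA _.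
exact: lebesgue_measure_addr.
Qed.

Lemma ge0_integral_subr (c : R) (f : R -> \bar R) :
  measurable_fun setT f -> (forall x, 0 <= f x)%E ->
  (\int[mu]_x f (c - x)%R = \int[mu]_x f x)%E.
Proof.
move=> mf f0.
have mN : measurable_fun setT
    (-%R : measurableTypeR R -> measurableTypeR R) by [].
have mfc : measurable_fun setT (fun x => f (c + x)%R).
  by apply: measurableT_comp => //; exact: measurable_funD.
rewrite -(ge0_integral_addr c mf f0).
have := @ge0_integral_pushforward _ _ _ _ R _ mN mu setT (fun x => f (c + x)%R)
  measurableT mfc (fun y _ => f0 _).
rewrite preimage_setT /= => <-; apply: eq_measure_integral => A mA _.
exact: lebesgue_measureN.
Qed.
End lebesgue.

(** * Reflections of the plane *)

Local Ltac meas := repeat first [done | apply: measurable_funB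
  | apply: measurable_funD | apply: measurable_funM | apply: measurable_funN].

Section reflection.
Context {R : realType}.
Local Notation mu := (@lebesgue_measure R).
Implicit Types (b k : R) (p : R * R).

(** The linear form that is reflected; its second coefficient is normalised
    to 1. *)
Definition lform b p : R := b * p.1 + p.2.

(** The map [p |-> p - 2 (lform b p) v] with [v = (k, 1 - b * k)].  As
    [lform b v = 1], it is the linear involution that fixes the kernel of
    [lform b] and sends [v] to [- v]. *)
Definition oblique_refl b k p : R * R :=
  (p.1 - 2 * k * lform b p, p.2 - 2 * (1 - b * k) * lform b p).

Lemma measurable_lform b : measurable_fun setT (lform b).
Proof. by apply: measurable_funD => //; exact: measurable_funM. Qed.

Lemma measurable_oblique_refl b k : measurable_fun setT (oblique_refl b k).
Proof.
apply: measurable_fun_pair.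
  by meas; exact: measurable_lform.
by meas; exact: measurable_lform.
Qed.

Lemma lform_oblique_refl b k p : lform b (oblique_refl b k p) = - lform b p.
Proof. by rewrite /oblique_refl /lform /=; ring. Qed.

(** The reflection is the composition of a shear that turns [lform b] into the
    second coordinate, a shear in the first coordinate, and a sign change
    followed by the inverse of the initial shear.  Each factor acts on one
    coordinate at a time, as a translation or a point reflection of the line. *)
Lemma ge0_integral_oblique_refl b k (F : R * R -> \bar R) :
  measurable_fun setT F -> (forall p, 0 <= F p)%E ->
  (\int[mu \x mu]_p F (oblique_refl b k p) = \int[mu \x mu]_p F p)%E.
Proof.
move=> mF F0.
pose G p := F (p.1 - 2 * k * p.2, - p.2 - b * (p.1 - 2 * k * p.2)).
pose H p := F (p.1, - p.2 - b * p.1).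
have mG : measurable_fun setT G.
  by apply: measurableT_comp => //; apply: measurable_fun_pair; meas.
have mH : measurable_fun setT H.
  by apply: measurableT_comp => //; apply: measurable_fun_pair; meas.
have mFr : measurable_fun setT (F \o oblique_refl b k).
  by apply: measurableT_comp => //; exact: measurable_oblique_refl.
transitivity (\int[mu \x mu]_p G p)%E.
  rewrite !fubini_tonelli1 //; last by move=> p; exact: F0.
  apply: eq_integral => x _; rewrite /fubini_F /=.
  rewrite -(@ge0_integral_addr _ (b * x) (fun y => G (x, y))); first last.
  - by move=> z; exact: F0.
  - exact: measurable_fun_pair2.
  by apply: eq_integral => y _; rewrite /G /oblique_refl /lform /=;
    congr F; congr pair; ring.
transitivity (\int[mu \x mu]_p H p)%E.
  rewrite !fubini_tonelli2 //; try by move=> p; exact: F0.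
  apply: eq_integral => y _; rewrite /fubini_G /=.
  rewrite -(@ge0_integral_addr _ (- (2 * k * y)) (fun x => H (x, y)));
    first last.
  - by move=> z; exact: F0.
  - exact: measurable_fun_pair1.
  by apply: eq_integral => x _; rewrite /G /H /=; congr F; congr pair; ring.
rewrite !fubini_tonelli1 //; try by move=> p; exact: F0.
apply: eq_integral => x _; rewrite /fubini_F /=.
rewrite -(@ge0_integral_subr _ (- (b * x)) (fun y => F (x, y))); first last.
  - by move=> z; exact: F0.
  - exact: measurable_fun_pair2.
by apply: eq_integral => y _; rewrite /H /=; congr F; congr pair; ring.
Qed.
End reflection.

(** * Reflection invariance of two independent centred normal laws *)

(** The coefficient of the regression of [x] on [b * x + y] when [x] and [y] are
    uncorrelated with standard deviations [s] and [t]. *)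
Definition regression_coef (R : realType) (s t b : R) : R :=
  b * s ^+ 2 / (b ^+ 2 * s ^+ 2 + t ^+ 2).

Section normal2.
Context {R : realType} (s t : R) (s0 : s != 0) (t0 : t != 0).
Local Notation mu := (@lebesgue_measure R).

(** The joint density of independent N(0, s ^ 2) and N(0, t ^ 2) variables. *)
Definition normal_pdf2 (p : R * R) : R :=
  normal_pdf 0 s p.1 * normal_pdf 0 t p.2.

Lemma measurable_normal_pdf2 : measurable_fun setT normal_pdf2.
Proof.
apply: measurable_funM; apply: measurableT_comp => //;
  exact: measurable_normal_pdf.
Qed.

Lemma normal_pdf2_ge0 p : 0 <= normal_pdf2 p.
Proof. by rewrite mulr_ge0 ?normal_pdf_ge0. Qed.

Lemma normal_pdf2_refl b p : let k := regression_coef s t b in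
  normal_pdf2 (oblique_refl b k p) = normal_pdf2 p.
Proof.
move=> k; rewrite /normal_pdf2 !normal_pdfE // /normal_fun /=.
rewrite mulrACA [RHS]mulrACA -!expRD; congr (_ * expR _).
have s20 : 0 < s ^+ 2 by rewrite exprn_even_gt0.
have t20 : 0 < t ^+ 2 by rewrite exprn_even_gt0.
have D0 : b ^+ 2 * s ^+ 2 + t ^+ 2 != 0.
  by rewrite gt_eqF// ltr_wpDl// mulr_ge0 ?sqr_ge0.
rewrite /k /regression_coef /lform; field.
by rewrite t0 s0 exprMn.
Qed.

(** The law with density [normal_pdf2]. *)
Definition normal_prob2 (C : set (R * R)) : \bar R :=
  (\int[mu \x mu]_(p in C) (normal_pdf2 p)%:E)%E.

Let normal_prob20 : normal_prob2 set0 = 0%E.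
Proof. by rewrite /normal_prob2 integral_set0. Qed.

Let normal_prob2_ge0 A : (0 <= normal_prob2 A)%E.
Proof. by apply: integral_ge0 => p _; rewrite lee_fin normal_pdf2_ge0. Qed.

Let normal_prob2_sigma_additive : semi_sigma_additive normal_prob2.
Proof.
move=> /= A mA tA mUA.
rewrite /normal_prob2 ge0_integral_bigcup//=; last first.
- by move=> p _; rewrite lee_fin normal_pdf2_ge0.
- by apply/measurable_EFinP/measurable_funTS; exact: measurable_normal_pdf2.
apply: is_cvg_ereal_nneg_natsum_cond => n _ _.
by apply: integral_ge0 => /= x ?; rewrite lee_fin normal_pdf2_ge0.
Qed.

HB.instance Definition _ := isMeasure.Build _ _ _
  normal_prob2 normal_prob20 normal_prob2_ge0 normal_prob2_sigma_additive.

Lemma normal_prob2X A B : measurable A -> measurable B ->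
  normal_prob2 (A `*` B) = (normal_prob 0 s A * normal_prob 0 t B)%E.
Proof.
move=> mA mB.
rewrite /normal_prob2 integral_mkcond fubini_tonelli1/=; last 2 first.
- apply/(measurable_restrictT _ (measurableX mA mB)).
  by apply/measurable_EFinP/measurable_funTS; exact: measurable_normal_pdf2.
- move=> p; rewrite /patch; case: ifP => // _.
  by rewrite lee_fin normal_pdf2_ge0.
rewrite /normal_prob [in RHS]integral_mkcond -ge0_integralZr//; last 3 first.
- apply/(measurable_restrictT _ mA).
  by apply/measurable_EFinP/measurable_funTS; exact: measurable_normal_pdf.
- move=> x _; rewrite /patch; case: ifP => // _.
  by rewrite lee_fin normal_pdf_ge0.
- by apply: integral_ge0 => x _; rewrite lee_fin normal_pdf_ge0.
apply: eq_integral => x _; rewrite /fubini_F/= {2}/patch; case: ifPn => xA.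
  rewrite [in RHS]integral_mkcond -ge0_integralZl//; last 3 first.
  - apply/(measurable_restrictT _ mB).
    by apply/measurable_EFinP/measurable_funTS; exact: measurable_normal_pdf.
  - move=> y _; rewrite /patch; case: ifP => // _.
    by rewrite lee_fin normal_pdf_ge0.
  - by rewrite lee_fin normal_pdf_ge0.
  apply: eq_integral => y _; rewrite /patch in_setX/= xA/=; case: ifP => _ //.
  by rewrite mule0.
rewrite mul0e integral0_eq // => y _; rewrite /patch in_setX/= (negbTE xA) //.
Qed.

Lemma normal_prob2_refl b C : measurable C ->
  normal_prob2 (oblique_refl b (regression_coef s t b) @^-1` C) =
  normal_prob2 C.
Proof.
move=> mC; rewrite /normal_prob2 integral_mkcond [RHS]integral_mkcond.
rewrite -[RHS](ge0_integral_oblique_refl b (regression_coef s t b)).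
- apply: eq_integral => p _; rewrite /patch normal_pdf2_refl.
  congr (if _ then _ else _); apply/idP/idP => /[!inE].
- apply/(measurable_restrictT _ mC).
  by apply/measurable_EFinP/measurable_funTS; exact: measurable_normal_pdf2.
- move=> p; rewrite /patch; case: ifP => // _.
  by rewrite lee_fin normal_pdf2_ge0.
Qed.

End normal2.

(** * Independent sequences with one reflected pair *)

Section mutual_independence.
Context d (T : measurableType d) (R : realType) (P : probability T R).

Lemma mutually_independent_comp (I J : eqType) (X : I -> {RV P >-> R})
    (f : J -> I) (g : I -> J) : cancel f g ->
  mutually_independent X -> mutually_independent (X \o f).
Proof.
move=> fK indX s A us mA.
have := indX (map f s) (A \o g); rewrite map_inj_uniq; last exact: can_inj fK.
move=> /(_ us (fun i => mA _)).
rewrite big_map; under eq_bigr do rewrite /= fK.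
move=> <-; congr (P _); apply/seteqP; split => w /= h.
  by move=> _ /mapP[j js ->] /=; rewrite fK; exact: h.
by move=> j js; have := h (f j) (map_f f js); rewrite /= fK.
Qed.

Variables (I : choiceType) (X : I -> {RV P >-> R}) (p q : I) (s t : R).
Hypothesis indX : mutually_independent X.
Hypothesis Xp : forall A, measurable A ->
  distribution P (X p) A = normal_prob 0 s A.
Hypothesis Xq : forall A, measurable A ->
  distribution P (X q) A = normal_prob 0 t A.

Lemma measurable_preimage (f : {RV P >-> R}) A :
  measurable A -> measurable (f @^-1` A).
Proof.
by move=> mA; rewrite -[X in measurable X]setTI; exact: measurable_funP.
Qed.

(** The pair [(X p, X q)] has law [normal_prob2 s t] and is independent of the
    event [Q] on finitely many of the other variables; [C] need not be a
    rectangle. *)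
Lemma independent_normal_pair_law (r : seq I) (A : I -> set R)
    (C : set (R * R)) :
  uniq [:: p, q & r] -> (forall i, measurable (A i)) -> measurable C ->
  let Q := \bigcap_(i in [set` r]) (X i @^-1` A i) in
  P (Q `&` [set w | C (X p w, X q w)]) = (P Q * normal_prob2 s t C)%E.
Proof.
move=> u mA mC Q.
have mQ : measurable Q.
  rewrite /Q bigcap_seq; apply: bigsetI_measurable => i _.
  exact: measurable_preimage.
have mY : measurable_fun setT (fun w => (X p w, X q w)).
  by apply: measurable_fun_pair.
pose Y w := (X p w, X q w).
have PQ : P Q = (fine (P Q))%:E by rewrite fineK// fin_num_measure.
have PQ0 : 0 <= fine (P Q) by rewrite fine_ge0.
pose m1 : {measure set (R * R) -> \bar R} := pushforward (mrestr P mQ) Y.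
pose m2 : {measure set (R * R) -> \bar R} :=
  mscale (NngNum PQ0) (normal_prob2 s t).
have m1E D : m1 mY D = P ((Y @^-1` D) `&` Q) by [].
have m2E D : m2 D = (P Q * normal_prob2 s t D)%E.
  by rewrite [RHS](congr1 (fun x => x * _)%E PQ).
rewrite -m2E setIC -m1E.
apply: prod_measure_rect_unique => //.
  have -> : m1 mY setT = P Q by rewrite -[in RHS](setTI Q).
  by rewrite PQ ltry.
move=> A1 A2 mA1 mA2.
rewrite m1E m2E normal_prob2X //.
pose A' i := if i == p then A1 else if i == q then A2 else A i.
have mA' i : measurable (A' i) by rewrite /A'; do 2 case: ifP => // _.
have /= /and3P[] := u; rewrite inE negb_or => /andP[pq pr] qr ur.
have Ar i : i \in r -> A' i = A i.
  move=> ir; rewrite /A'; case: eqP => [ip|_]; first by rewrite -ip ir in pr.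
  by case: eqP => [iq|//]; rewrite -iq ir in qr.
have A'p : A' p = A1 by rewrite /A' eqxx.
have A'q : A' q = A2 by rewrite /A' eqxx eq_sym (negbTE pq).
have := indX u mA'; rewrite !big_cons A'p A'q -Xp// -Xq//.
have -> : (\prod_(j <- r) P (X j @^-1` A' j) = P Q)%E.
  rewrite -indX//; congr (P _); apply/seteqP; split => w h i /= ir.
    by rewrite -Ar//; exact: h.
  by rewrite Ar//; exact: h.
rewrite /distribution /pushforward muleA [RHS]muleC => <-.
congr (P _); apply/seteqP; split => w /=.
  move=> [[Yp Yq] Qw] i /=; rewrite !inE => /or3P[/eqP->|/eqP->|ir].
  - by rewrite A'p.
  - by rewrite A'q.
  - by rewrite Ar//; exact: Qw.
move=> h; split; first split => /=.
- by have := h p; rewrite A'p; apply; rewrite /= inE eqxx.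
- by have := h q; rewrite A'q; apply; rewrite /= !inE eqxx orbT.
- by move=> i /= ir; rewrite -Ar//; apply: h; rewrite /= !inE ir !orbT.
Qed.

End mutual_independence.

Section reflected_sequence.
Context d (T : measurableType d) (R : realType) (P : probability T R).
Variables (X : nat -> {RV P >-> R}) (p q : nat) (s t : R).
Hypothesis indX : mutually_independent X.
Hypotheses (s0 : s != 0) (t0 : t != 0) (pq : p != q).
Hypothesis Xp : forall A, measurable A ->
  distribution P (X p) A = normal_prob 0 s A.
Hypothesis Xq : forall A, measurable A ->
  distribution P (X q) A = normal_prob 0 t A.
Variable b : R.

(** The sequence [x] with its terms [x p] and [x q] replaced by the coordinates
    of the reflection of [(x p, x q)]. *)
Definition refl_seq (k : R) (x : nat -> R) (i : nat) : R :=
  if i == p then (oblique_refl b k (x p, x q)).1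
  else if i == q then (oblique_refl b k (x p, x q)).2 else x i.

Let k := regression_coef s t b.

Lemma measurable_refl_seq i :
  measurable_fun setT (fun w => refl_seq k (X ^~ w) i).
Proof.
have mr : measurable_fun setT (fun w => oblique_refl b k (X p w, X q w)).
  apply: measurableT_comp; first exact: measurable_oblique_refl.
  exact: measurable_fun_pair.
rewrite /refl_seq; have [_|_] := eqVneq i p; first exact: measurableT_comp mr.
by have [_|_] := eqVneq i q; first exact: measurableT_comp mr.
Qed.

(** The first [n] terms of a sequence. *)
Definition seq_tuple n (x : nat -> R) : n.-tuple R := [tuple x i | i < n].

Lemma measurable_seq_tuple n (Y : nat -> T -> R) :
  (forall i, measurable_fun setT (Y i)) ->
  measurable_fun setT (fun w => seq_tuple n (Y ^~ w)).
Proof.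
move=> mY; apply/measurable_fun_tnthP => i.
by apply: eq_measurable_fun (mY i) => w _; rewrite /= tnth_mktuple.
Qed.

(** Reflecting the independent centred normal pair [(X p, X q)] preserves the
    law of the first [n] terms of the whole sequence. *)
Lemma law_refl_seq n (C : set (n.-tuple R)) :
  (p < n)%N -> (q < n)%N -> measurable C ->
  P [set w | C (seq_tuple n (refl_seq k (X ^~ w)))] =
  P [set w | C (seq_tuple n (X ^~ w))].
Proof.
move=> pn qn mC.
have mV := @measurable_seq_tuple n X (fun i => measurable_funP (X i)).
have mV' := @measurable_seq_tuple n _ measurable_refl_seq.
pose V w := seq_tuple n (X ^~ w).
pose V' w := seq_tuple n (refl_seq k (X ^~ w)).
pose m1 : {measure set (n.-tuple R) -> \bar R} := pushforward P V'.
pose m2 : {measure set (n.-tuple R) -> \bar R} := pushforward P V.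
apply: (@tuple_measure_rect_unique _ _ _ n (m1 mV') (m2 mV)) => //.
  have -> : m1 mV' setT = P setT by [].
  by rewrite probability_setT ltry.
move=> A mA.
(* [A] as a family indexed by nat, without constraint from [n] on. *)
pose B i := if insub i is Some j then A j else setT.
have mB i : measurable (B i) by rewrite /B; case: insub.
have BA (i : 'I_n) : B i = A i by rewrite /B valK.
pose r := [seq i <- iota 0 n | (i != p) && (i != q)].
have u : uniq [:: p, q & r].
  rewrite /= inE negb_or pq !mem_filter !eqxx /= andbF /=.
  by rewrite filter_uniq// iota_uniq.
pose C2 := B p `*` B q.
have mC2 : measurable C2 by exact: measurableX.
have law C' mC' := independent_normal_pair_law (C := C') indX Xp Xq u mB mC'.
have mem i : (i < n)%N -> [\/ i = p, i = q | i \in r].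
  move=> i_n; rewrite mem_filter mem_iota add0n i_n andbT.
  case: (eqVneq i p) => [->|ip]; first exact: Or31.
  by case: (eqVneq i q) => [->|iq]; [exact: Or32|exact: Or33].
have rE i : i \in r -> [/\ i != p, i != q & (i < n)%N].
  by rewrite mem_filter mem_iota add0n leq0n => /andP[/andP[ip iq] i_n]; split.
transitivity (P ((\bigcap_(i in [set` r]) (X i @^-1` B i)) `&`
   [set w | (oblique_refl b k @^-1` C2) (X p w, X q w)])).
  congr (P _); apply/seteqP; split => w /= h.
    split; [move=> i /= ir|split].
    - have [ip iq i_n] := rE _ ir; have := h (Ordinal i_n).
      by rewrite tnth_mktuple /refl_seq /= (negbTE ip) (negbTE iq) -BA.
    - by have := h (Ordinal pn); rewrite tnth_mktuple /refl_seq eqxx -BA.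
    - have := h (Ordinal qn).
      by rewrite tnth_mktuple /refl_seq eqxx eq_sym (negbTE pq) -BA.
  move=> i; rewrite tnth_mktuple -BA; have [hr [hp hq]] := h.
  have [->|->|ir] := mem i (ltn_ord i).
  - by rewrite /refl_seq eqxx.
  - by rewrite /refl_seq eqxx eq_sym (negbTE pq).
  - have [ip iq _] := rE _ ir.
    by rewrite /refl_seq (negbTE ip) (negbTE iq); exact: hr.
have mr : measurable (oblique_refl b k @^-1` C2).
  by rewrite -[X in measurable X]setTI; exact: measurable_oblique_refl.
rewrite (law _ mr) normal_prob2_refl// -(law _ mC2).
congr (P _); apply/seteqP; split => w /= h.
  move=> i; rewrite tnth_mktuple -BA; have [hr [hp hq]] := h.
  by have [->|->|ir] := mem i (ltn_ord i); last exact: hr.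
split; [move=> i /= ir|split].
- have [ip iq i_n] := rE _ ir; have := h (Ordinal i_n).
  by rewrite tnth_mktuple -BA.
- by have := h (Ordinal pn); rewrite tnth_mktuple -BA.
- by have := h (Ordinal qn); rewrite tnth_mktuple -BA.
Qed.

End reflected_sequence.

(** * Expectations, means and variances *)

Section same_law.
Context d d' (T : measurableType d) (U : measurableType d') (R : realType).
Variables (P : probability T R) (Y Y' : T -> U).
Hypotheses (mY : measurable_fun setT Y) (mY' : measurable_fun setT Y').
Hypothesis YY' : forall C, measurable C -> P (Y @^-1` C) = P (Y' @^-1` C).

Lemma ge0_integral_same_law (f : U -> \bar R) :
  measurable_fun setT f -> (forall u, 0 <= f u)%E ->
  (\int[P]_w f (Y w) = \int[P]_w f (Y' w))%E.
Proof.
move=> mf f0.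
have := ge0_integral_pushforward mY P measurableT mf (fun y _ => f0 y).
have := ge0_integral_pushforward mY' P measurableT mf (fun y _ => f0 y).
rewrite !preimage_setT => <- <-.
pose m1 : {measure set U -> \bar R} := pushforward P Y.
pose m2 : {measure set U -> \bar R} := pushforward P Y'.
by apply: (@eq_measure_integral _ _ _ _ (m2 mY') (m1 mY)) => A mA _; exact: YY'.
Qed.

Lemma integral_same_law (f : U -> \bar R) : measurable_fun setT f ->
  (\int[P]_w f (Y w) = \int[P]_w f (Y' w))%E.
Proof.
move=> mf; rewrite integralE [RHS]integralE.
have E (Z : T -> U) : ((fun w => f (Z w))^\+ = f^\+ \o Z)%E.
  exact: funepos_comp.
have E' (Z : T -> U) : ((fun w => f (Z w))^\- = f^\- \o Z)%E.
  exact: funeneg_comp.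
rewrite (E Y) (E Y') (E' Y) (E' Y').
congr (_ - _)%E; apply: ge0_integral_same_law => //.
  exact: measurable_funepos.
exact: measurable_funeneg.
Qed.

End same_law.

Section moments.
Context d (T : measurableType d) (R : realType) (P : probability T R).

(** The integral of [X] is the difference of the integrals of its positive and
    negative parts.  If either of these is infinite, the difference is infinite
    too, as [+oo - +oo = -oo] by convention. *)
Lemma expectation_eq0_Lfun1 (X : {RV P >-> R}) :
  ('E_P[X] = 0)%E -> (X : T -> R) \in Lfun P 1.
Proof.
rewrite unlock => EX; apply/Lfun1_integrable.
have mX : measurable_fun setT (EFin \o X) by apply/measurable_EFinP.
apply/integrableP; split => //.
have {}EX : (\int[P]_x (EFin \o X)^\+ x - \int[P]_x (EFin \o X)^\- x = 0)%E.
  by rewrite -integralE.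
rewrite (_ : (fun x => `|(EFin \o X) x|)%E =
    fun x => (EFin \o X)^\+ x + (EFin \o X)^\- x)%E; last first.
  by rewrite -[LHS]/(abse \o (EFin \o X)) fune_abse.
have p0 : (0 <= \int[P]_x (EFin \o X)^\+ x)%E by exact: integral_ge0.
have n0 : (0 <= \int[P]_x (EFin \o X)^\- x)%E by exact: integral_ge0.
rewrite ge0_integralD//; [|exact: measurable_funepos|exact: measurable_funeneg].
move: EX p0 n0.
case: (integral _ _ (EFin \o X)^\+)%E => [a| |];
  case: (integral _ _ (EFin \o X)^\-)%E => [b| |] //= *; by rewrite ltry.
Qed.

(** [X] and [2 * m - X] have the same law. *)
Lemma normal_centred_mean0 (X : {RV P >-> R}) (m s : R) : s != 0 ->
  (forall A, measurable A -> distribution P X A = normal_prob m s A) ->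
  ('E_P[X] = 0)%E -> m = 0.
Proof.
move=> s0 lawX EX; have lX := expectation_eq0_Lfun1 EX.
have mX' : measurable_fun setT (fun w => 2 * m - X w) by exact: measurable_funB.
have sym A : measurable A -> P (X @^-1` A) = P ((fun w => 2 * m - X w) @^-1` A).
  move=> mA; pose A' := (fun x => 2 * m - x) @^-1` A.
  have mA' : measurable A'.
    rewrite -[X in measurable X]setTI.
    have mf : measurable_fun setT (fun x : R => 2 * m - x).
      exact: measurable_funB.
    exact: mf.
  have := lawX _ mA; have := lawX _ mA'.
  rewrite /distribution /pushforward => -> ->.
  rewrite /normal_prob integral_mkcond [RHS]integral_mkcond.
  rewrite -(@ge0_integral_subr _ (2 * m)); last 2 first.
  - apply/(measurable_restrictT _ mA).
    by apply/measurable_EFinP/measurable_funTS; exact: measurable_normal_pdf.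
  - move=> x; rewrite /patch; case: ifP => // _.
    by rewrite lee_fin normal_pdf_ge0.
  apply: eq_integral => x _; rewrite /patch !normal_pdfE // /normal_fun.
  have -> : - (2 * m - x - m) ^+ 2 = - (x - m) ^+ 2 by ring.
  by congr (if _ then _ else _); apply/idP/idP => /[!inE].
have mE : measurable_fun setT (@EFin R).
  by apply/measurable_EFinP; exact: measurable_id.
have /= := integral_same_law (measurable_funP X) mX' sym mE.
have lc : cst (2 * m) \in Lfun P 1 by exact: Lfun_cst.
have := expectationB lc lX; rewrite EX expectation_cst sube0.
move: EX; rewrite expectation.unlock => -> /= -> [] ?; lra.
Qed.

Lemma centred_variance (X : {RV P >-> R}) : ('E_P[X] = 0)%E ->
  ('V_P[X] = \int[P]_w ((X w) ^+ 2)%:E)%E.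
Proof.
move=> EX; rewrite /variance covariance.unlock EX /= unlock.
by apply: eq_integral => w _; rewrite !fctE /= subr0 expr2.
Qed.

Lemma Lfun1_mul_bounded (Y g : T -> R) (K : R) : Y \in Lfun P 1 ->
  measurable_fun setT g -> (forall w, `|g w| <= K) ->
  (fun w => Y w * g w) \in Lfun P 1.
Proof.
move=> /Lfun1_integrable iY mg gK; apply/Lfun1_integrable.
apply: (eq_integrable _ ((EFin \o Y) \* (EFin \o g))%E) => //.
apply: integrableMl => //; exists K; split; first exact: num_real.
by move=> x Kx w _; exact: le_trans (gK w) (ltW Kx).
Qed.
End moments.

(** * Expectations under a reflection *)

Section reflected_expectation.
Context d (T : measurableType d) (R : realType) (P : probability T R).
Variables (X : nat -> {RV P >-> R}) (p q : nat) (s t : R).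
Hypothesis indX : mutually_independent X.
Hypotheses (s0 : s != 0) (t0 : t != 0) (pq : p != q).
Hypothesis Xp : forall A, measurable A ->
  distribution P (X p) A = normal_prob 0 s A.
Hypothesis Xq : forall A, measurable A ->
  distribution P (X q) A = normal_prob 0 t A.

(** Variances are proportional to squared scale parameters; the second moment of
    the standard normal law is not needed. *)
Lemma variance_ratio (v1 v2 : R) :
  ('E_P[X p] = 0)%E -> ('E_P[X q] = 0)%E ->
  ('V_P[X p] = v1%:E)%E -> ('V_P[X q] = v2%:E)%E ->
  v1 * t ^+ 2 = v2 * s ^+ 2.
Proof.
move=> Ep Eq Vp Vq.
(* For this slope the reflection maps [X p] to a multiple of [X q]. *)
pose b := t / s; pose k := regression_coef s t b.
pose n := (maxn p q).+1.
have pn : (p < n)%N by rewrite ltnS leq_maxl.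
have qn : (q < n)%N by rewrite ltnS leq_maxr.
have mV :=
  @measurable_seq_tuple _ _ _ n X (fun i => measurable_funP (X i)).
have mV' := @measurable_seq_tuple _ _ _ n _ (measurable_refl_seq X p q s t b).
have law (C : set (n.-tuple R)) :=
  law_refl_seq (C := C) indX s0 t0 pq Xp Xq b pn qn.
pose f (v : n.-tuple R) : \bar R := ((tnth v (Ordinal pn)) ^+ 2)%:E.
have mf : measurable_fun setT f.
  by apply/measurable_EFinP/measurable_funX; exact: measurable_tnth.
have f0 v : (0 <= f v)%E by rewrite lee_fin sqr_ge0.
have := ge0_integral_same_law mV' mV law mf f0.
under [X in _ = X -> _]eq_integral do rewrite /f tnth_mktuple.
rewrite -centred_variance // Vp.
have kE x y : (oblique_refl b k (x, y)).1 = - (s / t) * y.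
  rewrite /oblique_refl /lform /k /regression_coef /b /=; field.
  by rewrite s0 t0 /= -mulr2n mulrn_eq0 sqrf_eq0.
under eq_integral do rewrite /f tnth_mktuple /refl_seq eqxx kE exprMn EFinM.
rewrite ge0_integralZl//; last 3 first.
- by apply/measurable_EFinP/measurable_funX.
- by move=> w _; rewrite lee_fin sqr_ge0.
- by rewrite lee_fin sqr_ge0.
rewrite -centred_variance// Vq -EFinM => -[<-].
by field.
Qed.

Variable b : R.
Let k := regression_coef s t b.

(** With [V] the sequence and [V'] the reflected one, equality of the laws
    and the sign change of the linear form [L] give
    [2 E[L h(V)] = E[L (h(V) - h(V'))]]. *)
Lemma reflection_expectation_ge0 n (h : n.-tuple R -> R) (K : R) :
  (p < n)%N -> (q < n)%N ->
  (X p : T -> R) \in Lfun P 1 -> (X q : T -> R) \in Lfun P 1 ->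
  measurable_fun setT h -> (forall v, `|h v| <= K) ->
  (forall w, 0 <= lform b (X p w, X q w) *
     (h (seq_tuple n (X ^~ w)) -
      h (seq_tuple n (refl_seq p q b k (X ^~ w))))) ->
  (0 <= 'E_P[(fun w => lform b (X p w, X q w) * h (seq_tuple n (X ^~ w)))%R])%E.
Proof.
move=> pn qn lp lq mh hK hge.
have mV :=
  @measurable_seq_tuple _ _ _ n X (fun i => measurable_funP (X i)).
have mV' := @measurable_seq_tuple _ _ _ n _ (measurable_refl_seq X p q s t b).
have law (C : set (n.-tuple R)) :=
  law_refl_seq (C := C) indX s0 t0 pq Xp Xq b pn qn.
pose L w := lform b (X p w, X q w).
have lL : L \in Lfun P 1.
  rewrite (_ : L = (b *: (X p : T -> R)) + (X q : T -> R)) //.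
  by rewrite rpredD // rpredZ.
pose V w := seq_tuple n (X ^~ w).
pose V' w := seq_tuple n (refl_seq p q b k (X ^~ w)).
have lV : (fun w => L w * h (V w)) \in Lfun P 1.
  by apply: (@Lfun1_mul_bounded _ _ _ _ _ _ K) => //; exact: measurableT_comp.
have lV' : (fun w => L w * h (V' w)) \in Lfun P 1.
  by apply: (@Lfun1_mul_bounded _ _ _ _ _ _ K) => //; exact: measurableT_comp.
pose LV w := L w * h (V w); pose LV' w := L w * h (V' w).
pose G (v : n.-tuple R) : R :=
  lform b (tnth v (Ordinal pn), tnth v (Ordinal qn)) * h v.
have mG : measurable_fun setT G.
  apply: measurable_funM => //.
  apply: measurableT_comp; first exact: measurable_lform.
  by apply: measurable_fun_pair; exact: measurable_tnth.
have E : ('E_P[LV] = - 'E_P[LV'])%E.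
  have -> : (- 'E_P[LV'] = 'E_P[((-1) \o* LV')%R])%E.
    by rewrite expectationZl// EFinN mulN1e.
  rewrite unlock.
  have := integral_same_law mV mV' (fun C mC => esym (law C mC))
    (proj2 (measurable_EFinP setT G) mG).
  rewrite /G /=.
  under eq_integral do rewrite !tnth_mktuple.
  move=> ->; apply: eq_integral => w _; rewrite !tnth_mktuple.
  rewrite {1 2}/refl_seq eqxx eqxx eq_sym (negbTE pq).
  rewrite -surjective_pairing lform_oblique_refl.
  by rewrite mulrN1 mulNr.
have fE : ('E_P[LV])%E \is a fin_num by exact: expectation_fin_num.
have : (0 <= 'E_P[LV] + 'E_P[LV])%E.
  rewrite [X in (_ + X)%E]E -expectationB //; apply: expectation_ge0 => w /=.
  by rewrite -mulrBr; exact: hge.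
rewrite -[X in (_ -> (_ <= X)%E)]/('E_P[LV])%E -(fineK fE) -EFinD !lee_fin; lra.
Qed.
End reflected_expectation.

(** * Truncation *)

Section clip.
Context {R : realType}.
Implicit Types (a y : R) (N : nat).

(** The truncation of [y] at the levels [- N] and [N]. *)
Definition clip N y : R := Num.max (- N%:R) (Num.min N%:R y).

Local Ltac clip_cases :=
  rewrite /clip /Num.max /Num.min; repeat case: ifPn; rewrite -?leNgt; lra.

Lemma clip_bound N y : `|clip N y| <= N%:R.
Proof.
have N0 : 0 <= N%:R :> R by [].
by rewrite ler_norml; apply/andP; split; clip_cases.
Qed.

Lemma clip_homo N : {homo clip N : x y / x <= y}.
Proof.
move=> x y xy; have N0 : 0 <= N%:R :> R by [].
by clip_cases.
Qed.

Lemma measurable_clip N : measurable_fun setT (clip N).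
Proof. by apply: measurable_maxr => //; exact: measurable_minr. Qed.

Lemma clip_id N y : `|y| <= N%:R -> clip N y = y.
Proof.
by rewrite ler_norml => /andP[Ny yN]; rewrite /clip (min_idPr yN) (max_idPr Ny).
Qed.

Lemma maxr0_mul_le a x y : (0 <= x <= y) || (y <= x <= 0) ->
  Num.max (a * x) 0 <= Num.max (a * y) 0.
Proof.
move=> xy; rewrite ge_max !le_max lexx orbT andbT.
have [a0|a0] := leP 0 a; case/orP: xy => /andP[xy yx].
- by rewrite ler_wpM2l.
- by rewrite mulr_ge0_le0 ?orbT.
- by rewrite mulr_le0_ge0 ?orbT// ltW.
- by rewrite ler_wnM2l// ltW.
Qed.

Lemma maxr0_clip_le N M a y : (N <= M)%N ->
  Num.max (a * clip N y) 0 <= Num.max (a * clip M y) 0.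
Proof.
move=> NM; have NM' : N%:R <= M%:R :> R by rewrite ler_nat.
have N0 : 0 <= N%:R :> R by [].
apply: maxr0_mul_le; apply/orP.
by have [y0|y0] := leP 0 y; [left|right]; apply/andP; split; clip_cases.
Qed.

Lemma maxr0_clip_le_id N a y : Num.max (a * clip N y) 0 <= Num.max (a * y) 0.
Proof.
have N0 : 0 <= N%:R :> R by [].
apply: maxr0_mul_le; apply/orP.
by have [y0|y0] := leP 0 y; [left|right]; apply/andP; split; clip_cases.
Qed.
End clip.

Section clipped_expectation.
Context d (T : measurableType d) (R : realType) (P : probability T R).

(** The negative parts of the truncated products increase to that of [D F], and
    their integrals are at most those of the positive parts, hence at most the
    integral of the positive part of [D F]. *)
Lemma expectation_ge0_clip (D F : T -> R) :
  measurable_fun setT D -> measurable_fun setT F ->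
  (forall N, (fun w => D w * clip N (F w)) \in Lfun P 1) ->
  (forall N, 0 <= 'E_P[(fun w => D w * clip N (F w))%R])%E ->
  expectation_defined P (fun w => D w * F w) ->
  (0 <= 'E_P[(fun w => D w * F w)%R])%E.
Proof.
move=> mD mF lN EN.
pose Y w := D w * F w; pose YN N w := D w * clip N (F w).
have mY : measurable_fun setT Y by exact: measurable_funM.
have mYN N : measurable_fun setT (YN N).
  apply: measurable_funM => //; apply: measurableT_comp => //.
  exact: measurable_clip.
rewrite -/Y /expectation_defined !expectation.unlock => dY.
rewrite integralE -/(EFin \o Y) funerpos funerneg.
set pY := (\int[P]_x _)%E; set nY := (\int[P]_x _)%E.
suff nYpY : (nY <= pY)%E.
  have p0 : (0 <= pY)%E by apply: integral_ge0 => w _; rewrite lee_fin.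
  have n0 : (0 <= nY)%E by apply: integral_ge0 => w _; rewrite lee_fin.
  rewrite sube_ge0 // !ge0_fin_numE //; apply/orP.
  by case: dY => [pY_oo|nY_oo]; [right|left].
have nYN : (\int[P]_w (((YN N)^\-)%R w)%:E)%E @[N --> \oo] --> nY.
  have -> : nY = (\int[P]_w limn (fun N => (((YN N)^\-)%R w)%:E))%E.
    apply: eq_integral => w _; apply/esym/cvg_lim => //.
    apply: (@cvg_near_cst _ _ _ _ (\oo)).
    have := nbhs_infty_ger `|F w|; apply: filterS => N FN.
    by rewrite /= /funrneg /YN /Y clip_id.
  apply: cvg_monotone_convergence => //.
  - by move=> N; apply/measurable_EFinP; exact: measurable_funrneg.
  - by move=> N w _; rewrite lee_fin.
  - move=> w _ N M NM; rewrite lee_fin /funrneg /YN -!mulNr.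
    exact: maxr0_clip_le.
apply: cvge_to_le nYN _; near=> N.
have : ((\int[P]_w (((YN N)^\-)%R w)%:E) <= (\int[P]_w (((YN N)^\+)%R w)%:E))%E.
  have := EN N; rewrite expectation.unlock integralE -/(EFin \o YN N).
  rewrite funerpos funerneg.
  rewrite sube_ge0 //.
  have /Lfun1_integrable/integrable_funepos := lN N.
  move=> /(_ measurableT); rewrite funerpos.
  move=> /(integrable_fin_num measurableT) fp.
  by rewrite fp orbT.
move/le_trans; apply; apply: ge0_le_integral => //.
- by move=> w _; rewrite lee_fin.
- by apply/measurable_EFinP; exact: measurable_funrpos.
- by apply/measurable_EFinP; exact: measurable_funrpos.
- by move=> w _; rewrite lee_fin; exact: maxr0_clip_le_id.
Unshelve. all: by end_near. Qed.
End clipped_expectation.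

(** * The linear model *)

Lemma mul_nondecreasing_diff_ge0 (R : realType) n (f : n.-tuple R -> R)
    (x y : n.-tuple R) (l : R) (c : 'I_n -> R) :
  componentwise_nondecreasing f -> (forall i, 0 <= c i) ->
  (forall i, tnth x i - tnth y i = c i * l) -> 0 <= l * (f x - f y).
Proof.
move=> ndf c0 xy; have [l0|l0] := leP 0 l.
  rewrite mulr_ge0// subr_ge0; apply: ndf => i.
  by rewrite -subr_ge0 xy mulr_ge0.
rewrite mulr_le0 ?(ltW l0)// subr_le0; apply: ndf => i.
by rewrite -subr_le0 xy mulr_ge0_le0// ltW.
Qed.

Section linear_model.
Context d (T : measurableType d) (R : realType) (P : probability T R).
Variables (X : nat -> {RV P >-> R}) (beta : nat -> R) (j : nat) (s t u : R).
Hypothesis indX : mutually_independent X.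
Hypotheses (s0 : s != 0) (t0 : t != 0) (u0 : u != 0).
Hypothesis X0 : forall A, measurable A ->
  distribution P (X 0%N) A = normal_prob 0 s A.
Hypothesis Xj : forall A, measurable A ->
  distribution P (X j.+1) A = normal_prob 0 t A.
Hypothesis XSj : forall A, measurable A ->
  distribution P (X j.+2) A = normal_prob 0 u A.
Hypothesis lX : forall i, (X i : T -> R) \in Lfun P 1.
Hypothesis beta_ge0 : forall n, 0 <= beta n.
Hypothesis betaj : 0 < beta j.
Hypothesis growth : t ^+ 2 <= (beta j.+1 - beta j) * beta j * s ^+ 2.

(** The tuple [(S_0, ..., S_j)], the sequence [x] listing [Z] and then the
    [eps_i]: the noise [eps_i] has index [i + 1]. *)
Definition linear_tuple (x : nat -> R) : j.+1.-tuple R :=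
  [tuple beta i * x 0%N + x i.+1 | i < j.+1].

Let S n w := beta n * X 0%N w + X n.+1 w.

Lemma linear_model_bounded (f : j.+1.-tuple R -> R) (K : R) :
  measurable_fun setT f -> componentwise_nondecreasing f ->
  (forall v, `|f v| <= K) ->
  (0 <= 'E_P[(fun w => (S j.+1 w - S j w) *
                       f (linear_tuple (X ^~ w)))%R])%E.
Proof.
move=> mf ndf fK.
(* The variables involved are [Z, eps_0, ..., eps_(j+1)]. *)
pose h (v : j.+3.-tuple R) := f (linear_tuple (fun i => nth 0 v i)).
have nthE x i : (i < j.+3)%N -> nth 0 (seq_tuple j.+3 x) i = x i.
  by move=> ij; rewrite -(tnth_nth 0 _ (Ordinal ij)) tnth_mktuple.
have hE x : h (seq_tuple j.+3 x) = f (linear_tuple x).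
  rewrite /h; congr f; apply: eq_from_tnth => i; rewrite !tnth_mktuple.
  by rewrite !nthE// ltnS ltnW// ltnS.
have mh : measurable_fun setT h.
  apply: measurableT_comp => //; apply/measurable_fun_tnthP => i.
  have mnth k : (k < j.+3)%N ->
      measurable_fun setT (fun v : j.+3.-tuple R => nth 0 v k).
    move=> kj; apply: eq_measurable_fun (measurable_tnth (Ordinal kj)) => v _.
    by rewrite (tnth_nth 0).
  apply: (eq_measurable_fun
    (fun v : j.+3.-tuple R => beta i * nth 0 v 0%N + nth 0 v i.+1)).
    by move=> v _; rewrite /= tnth_mktuple.
  apply: measurable_funD; last by apply: mnth; rewrite ltnS ltnW// ltnS.
  by apply: measurable_funM => //; exact: mnth.
have hK v : `|h v| <= K by exact: fK.
have mNh : measurable_fun setT (fun v => - h v) by exact: measurable_funN.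
have NhK v : `|- h v| <= K by rewrite normrN; exact: fK.
pose k := regression_coef s t (beta j).
have s20 : 0 < s ^+ 2 by rewrite exprn_even_gt0.
have t20 : 0 < t ^+ 2 by rewrite exprn_even_gt0.
have D0 : 0 < beta j ^+ 2 * s ^+ 2 + t ^+ 2.
  by rewrite addr_gt0// mulr_gt0// exprn_gt0.
have k0 : 0 <= k.
  by rewrite /k /regression_coef divr_ge0// ?ltW// mulr_gt0.
(* [Z - k S_j = - k (b Z + eps_j)]: up to the sign, the residual is also a
   linear form with second coefficient 1. *)
pose b := - (t ^+ 2) / (beta j * s ^+ 2).
have kb : regression_coef s t b = - k.
  rewrite /b /k /regression_coef; field.
  have N0 : (- t ^+ 2) ^+ 2 + (t * (beta j * s)) ^+ 2 != 0.
    by rewrite gt_eqF// ltr_pwDl ?sqr_ge0// exprn_even_gt0//= oppr_eq0 gt_eqF.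
  by rewrite N0 -exprMn in D0 *; rewrite (gt_eqF D0) s0 (gt_eqF betaj).
have bk : k * b = beta j * k - 1.
  rewrite /b /k /regression_coef; field.
  by rewrite -exprMn in D0; rewrite (gt_eqF D0) s0 (gt_eqF betaj).
have E1 := reflection_expectation_ge0 indX s0 u0 (p := 0%N) (q := j.+2) isT
  X0 XSj (b := 0) (n := j.+3) isT (ltnSn _) (lX _) (lX _) mh hK.
have E2 := reflection_expectation_ge0 indX s0 t0 (p := 0%N) (q := j.+1) isT
  X0 Xj (b := beta j) (n := j.+3) isT (leqnSn _) (lX _) (lX _) mh hK.
have E3 := reflection_expectation_ge0 indX s0 t0 (p := 0%N) (q := j.+1) isT
  X0 Xj (b := b) (n := j.+3) isT (leqnSn _) (lX _) (lX _) mNh NhK.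
(* Reflecting [eps_(j+1)] does not move [S_0, ..., S_j]. *)
have {}E1 : (0 <= 'E_P[(fun w =>
    lform 0 (X 0%N w, X j.+2 w) * h (seq_tuple j.+3 (X ^~ w)))%R])%E.
  apply: E1 => w; rewrite !hE.
  apply: (mul_nondecreasing_diff_ge0 (c := fun=> 0)) => // i.
  rewrite !tnth_mktuple /refl_seq /oblique_refl /regression_coef /= eqSS.
  rewrite ltn_eqF//= mul0r mul0r mulr0 mul0r subr0; ring.
(* Reflecting [S_j] lowers it by [2 S_j], and [Z] by [2 k S_j]. *)
have {}E2 : (0 <= 'E_P[(fun w =>
    lform (beta j) (X 0%N w, X j.+1 w) * h (seq_tuple j.+3 (X ^~ w)))%R])%E.
  apply: E2 => w; rewrite !hE.
  apply: (mul_nondecreasing_diff_ge0 (c := fun i : 'I_j.+1 =>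
    if i == j :> nat then 2 else 2 * k * beta i)) => //.
    by move=> i; case: ifP => // _; rewrite mulr_ge0// mulr_ge0.
  move=> i; rewrite !tnth_mktuple /refl_seq /oblique_refl /= eqSS -/k.
  case: ifPn => [/eqP ->|_]; ring.
(* Reflecting the residual fixes [S_j], and lowers [Z] by twice the residual. *)
have {}E3 : (0 <= 'E_P[(fun w =>
    lform b (X 0%N w, X j.+1 w) * (- h (seq_tuple j.+3 (X ^~ w))))%R])%E.
  apply: E3 => w; rewrite kb !hE opprK addrC.
  apply: (mul_nondecreasing_diff_ge0 (c := fun i : 'I_j.+1 =>
    if i == j :> nat then 0 else 2 * k * beta i)) => //.
    by move=> i; case: ifP => // _; rewrite mulr_ge0// mulr_ge0.
  move=> i; rewrite !tnth_mktuple /refl_seq /oblique_refl /= eqSS.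
  case: ifPn => [/eqP ->|_]; last ring.
  set l := lform b _.
  have -> : beta j * (X 0%N w - 2 * - k * l) +
      (X j.+1 w - 2 * (1 - b * - k) * l) - (beta j * X 0%N w + X j.+1 w) =
      2 * (beta j * k - 1 - k * b) * l by ring.
  by rewrite bk subrr mulr0.
pose F w := f (linear_tuple (X ^~ w)).
have mX (i : nat) : measurable_fun setT (X i) by exact: measurable_funP.
have mF : measurable_fun setT F.
  apply: measurableT_comp => //; apply/measurable_fun_tnthP => i.
  apply: (eq_measurable_fun (fun w => beta i * X 0%N w + X i.+1 w)).
    by move=> w _; rewrite /= tnth_mktuple.
  by apply: measurable_funD => //; exact: measurable_funM.
have FK w : `|F w| <= K by exact: fK.
have lL (c : R) i : (fun w => lform c (X 0%N w, X i w)) \in Lfun P 1.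
  rewrite (_ : (fun w => _) = (c *: (X 0%N : T -> R)) + (X i : T -> R)) //.
  by rewrite rpredD // rpredZ.
pose Y1 w := lform 0 (X 0%N w, X j.+2 w) * F w.
pose Y2 w := lform (beta j) (X 0%N w, X j.+1 w) * F w.
pose Y3 w := lform b (X 0%N w, X j.+1 w) * (- F w).
have lY1 : Y1 \in Lfun P 1 by exact: (Lfun1_mul_bounded (lL _ _) mF FK).
have lY2 : Y2 \in Lfun P 1 by exact: (Lfun1_mul_bounded (lL _ _) mF FK).
have lY3 : Y3 \in Lfun P 1.
  have mNF : measurable_fun setT (fun w => - F w) by exact: measurable_funN.
  by apply: (Lfun1_mul_bounded (lL _ _) mNF (K := K)) => w; rewrite normrN.
have {}E1 : (0 <= 'E_P[Y1])%E.
  by move: E1; under eq_fun do rewrite hE.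
have {}E2 : (0 <= 'E_P[Y2])%E.
  by move: E2; under eq_fun do rewrite hE.
have {}E3 : (0 <= 'E_P[Y3])%E.
  by move: E3; under eq_fun do rewrite hE.
pose g := beta j.+1 - beta j.
have g0 : 0 <= (g + beta j) * k by rewrite mulr_ge0// /g subrK.
have a0 : 0 <= (g + beta j) * k - 1.
  have -> : (g + beta j) * k - 1 =
      (g * beta j * s ^+ 2 - t ^+ 2) / (beta j ^+ 2 * s ^+ 2 + t ^+ 2).
    by rewrite /k /regression_coef; field; rewrite exprMn gt_eqF.
  by rewrite divr_ge0 ?(ltW D0)// subr_ge0.
rewrite (_ : (fun w => _) = (Y1 \+ ((g + beta j) * k - 1) \o* Y2) \+
    ((g + beta j) * k) \o* Y3); last first.
  apply/funext => w; rewrite /Y1 /Y2 /Y3 /= /S /lform /= -/(F w).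
  have -> : (b * X 0%N w + X j.+1 w) * - F w * ((g + beta j) * k) =
      - ((g + beta j) * ((k * b) * X 0%N w + k * X j.+1 w) * F w) by ring.
  by rewrite bk /g; ring.
have lY2' : ((g + beta j) * k - 1) \o* Y2 \in Lfun P 1 by exact: Lfun_scale.
have lY3' : ((g + beta j) * k) \o* Y3 \in Lfun P 1 by exact: Lfun_scale.
rewrite expectationD//; last by rewrite rpredD.
rewrite expectationD// !expectationZl//.
by rewrite !adde_ge0// mule_ge0 ?lee_fin.
Qed.
End linear_model.

Theorem proposition1p5 (d : measure_display) (T : measurableType d)
    (R : realType) (P : probability T R)
    (Z : {RV P >-> R}) (eps : nat -> {RV P >-> R})
    (sigma1 sigma2 : R) (beta : nat -> R)
    (indep : mutually_independent
               (fun o : option nat => if o is Some n then eps n else Z))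
    (Z_normal : normally_distributed Z)
    (Z_centred : ('E_P[Z] = 0)%E)
    (Z_var : ('V_P[Z] = (sigma1 ^+ 2)%:E)%E)
    (sigma1_gt0 : 0 < sigma1 ^+ 2)
    (eps_normal : forall n, normally_distributed (eps n))
    (eps_centred : forall n, ('E_P[eps n] = 0)%E)
    (eps_var : forall n, ('V_P[eps n] = (sigma2 ^+ 2)%:E)%E)
    (sigma2_gt0 : 0 < sigma2 ^+ 2)
    (beta_nondecreasing : nondecreasing_seq beta)
    (beta_ge0 : forall n, 0 <= beta n)
    (beta_growth : forall j,
       sigma2 ^+ 2 <= (beta j.+1 - beta j) * beta j * sigma1 ^+ 2) :
  demimartingale P (fun n w => beta n * Z w + eps n w).
Proof.
pose X (o : option nat) := if o is Some n then eps n else Z.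
pose idx (i : nat) := if i is n.+1 then Some n else None.
have idxK : cancel idx (fun o => if o is Some n then n.+1 else 0%N) by case.
have indX : mutually_independent (X \o idx).
  exact: mutually_independent_comp idxK indep.
have centred_normal (Y : {RV P >-> R}) :
    normally_distributed Y -> ('E_P[Y] = 0)%E ->
    exists2 s, s != 0 &
      forall A, measurable A -> distribution P Y A = normal_prob 0 s A.
  move=> [m [s [s0 lawY]]] EY; exists s => // A mA.
  by rewrite -[0](normal_centred_mean0 s0 lawY EY) lawY.
have [s s0 lawZ] := centred_normal _ Z_normal Z_centred.
have lX i : ((X \o idx) i : T -> R) \in Lfun P 1.
  apply: expectation_eq0_Lfun1.
  by case: i => [|i]; [exact: Z_centred|exact: eps_centred].
pose S n w := beta n * Z w + eps n w.
have lS n : S n \in Lfun P 1.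
  rewrite (_ : S n = (beta n *: (Z : T -> R)) + (eps n : T -> R)) //.
  apply: rpredD; [apply: rpredZ; exact: lX 0%N|exact: lX n.+1].
split => [n|j f mf ndf Y]; first exact: lS.
have [t t0 laweps] := centred_normal _ (eps_normal j) (eps_centred j).
have [u u0 lawepsS] := centred_normal _ (eps_normal j.+1) (eps_centred j.+1).
have ratio : sigma1 ^+ 2 * t ^+ 2 = sigma2 ^+ 2 * s ^+ 2.
  exact: (variance_ratio indX s0 t0 (p := 0%N) (q := j.+1) isT lawZ laweps
    Z_centred (eps_centred j) Z_var (eps_var j)).
have betaj : 0 < beta j.
  rewrite lt_def beta_ge0 andbT; apply/eqP => betaj0.
  by have := beta_growth j; rewrite betaj0 mulr0 mul0r leNgt sigma2_gt0.
have growth : t ^+ 2 <= (beta j.+1 - beta j) * beta j * s ^+ 2.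
  rewrite -(ler_pM2l sigma1_gt0) ratio [leRHS]mulrA ler_wpM2r ?sqr_ge0//.
  by rewrite [leRHS]mulrC; exact: beta_growth.
have bounded := linear_model_bounded indX s0 t0 u0 lawZ laweps lawepsS lX
  beta_ge0 betaj growth.
have mS n : measurable_fun setT (S n).
  by apply: measurable_funD => //; exact: measurable_funM.
have mfS : measurable_fun setT (fun w => f [tuple S i w | i < j.+1]).
  apply: measurableT_comp => //; apply/measurable_fun_tnthP => i.
  by apply: (eq_measurable_fun (S i)) => // w _; rewrite /= tnth_mktuple.
apply: (expectation_ge0_clip (D := fun w => S j.+1 w - S j w)
  (F := fun w => f [tuple S i w | i < j.+1])).
- exact: measurable_funB.
- exact: mfS.
- move=> N.
  apply: (Lfun1_mul_bounded (K := N%:R)) => [||w]; last exact: clip_bound.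
    by rewrite (_ : (fun w => _) = S j.+1 - S j) // rpredB.
  by apply: measurableT_comp mfS; exact: measurable_clip.
- move=> N; apply: (bounded (clip N \o f) N%:R).
  + by apply: measurableT_comp => //; exact: measurable_clip.
  + by move=> x y xy; apply: clip_homo; exact: ndf.
  + by move=> v; exact: clip_bound.
Qed.
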